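(* Let $K$ be a field, $S=K[x_1,\ldots,x_n]$, and let $I$ be an almost complete intersection square-free monomial ideal of $S$. Then $S/I$ is clean.
   Context: For a monomial ideal $I$ of $S$, $G(I)$ denotes the unique minimal set of monomial generators of $I$, $\mu(I)$ denotes the number of elements of $G(I)$, and $\operatorname{ht} I$ is the height of $I$. A monomial ideal $I$ is said to be almost complete intersection if $\mu(I)=\operatorname{ht} I+1$. A monomial prime ideal is a prime ideal generated by a (possibly empty) subset of the variables. The ring $S/I$ is called clean if there exists a finite chain $I=I_0\subset I_1\subset\cdots\subset I_r=S$ of monomial ideals such that $I_i/I_{i-1}\cong S/\mathfrak p_i$ for monomial prime ideals $\mathfrak p_i$ of $S$ ($1\le i\le r$), and all the $\mathfrak p_i$ are minimal prime ideals of $I$. *)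

(* Defs.v *)
From HB Require Import structures.
From mathcomp Require Import all_boot all_order all_algebra.
From mathcomp Require Import boolp classical_sets functions cardinality.
From mathcomp Require Import mpoly.

Set Implicit Arguments.
Unset Strict Implicit.
Unset Printing Implicit Defensive.

Import GRing.Theory.
Local Open Scope classical_set_scope.
Local Open Scope ring_scope.

Section Ideals.
Variable R : comNzRingType.
Implicit Types (I P Q A B C D : set R).

(* An ideal is a submodule of the regular module R^o; the library predicate
   [idealr_closed] additionally requires 1 \notin I, so it is used for prime
   ideals only. *)
Definition is_ideal I : Prop := GRing.submod_closed (mem (I : set R^o)).

Definition is_prime_ideal P : Prop :=
  idealr_closed (mem P) /\ prime_idealr_closed (mem P).

Definition ideal_gen (X : set R) : set R := smallest is_ideal X.

Definition is_minimal_prime I P : Prop :=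
  [/\ is_prime_ideal P, I `<=` P &
      forall Q, is_prime_ideal Q -> I `<=` Q -> Q `<=` P -> Q = P].

Definition prime_chain P (k : nat) : Prop :=
  exists P_ : nat -> set R,
    [/\ forall i, (i <= k)%N -> is_prime_ideal (P_ i),
        forall i, (i < k)%N -> P_ i `<` P_ i.+1 & P_ k = P].

Definition has_prime_height P (h : nat) : Prop :=
  prime_chain P h /\ forall k, prime_chain P k -> (k <= h)%N.

(* The height of I is the minimum of the heights of the primes containing I;
   a prime of infinite height has no [has_prime_height] value, so it imposes no
   condition in the second clause, and [has_height setT h] never holds. *)
Definition has_height I (h : nat) : Prop :=
  (exists P, [/\ is_prime_ideal P, I `<=` P & has_prime_height P h]) /\
  (forall P k, is_prime_ideal P -> I `<=` P -> has_prime_height P k ->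
     (h <= k)%N).

(* For submodules B of A and D of C, the R-modules A/B and C/D are isomorphic:
   f gives, on representatives, a bijective R-linear map A/B -> C/D. *)
Definition subquotient_isom A B C D : Prop :=
  exists f : R -> R,
    [/\ forall u, A u -> C (f u),
        forall a u v, A u -> A v -> D (f (a * u + v) - (a * f u + f v)),
        forall u v, A u -> A v -> (D (f u - f v) <-> B (u - v)) &
        forall w, C w -> exists2 u, A u & D (f u - w)].

End Ideals.

Section MonomialIdeals.
Variables (K : fieldType) (n : nat).
Local Notation S := {mpoly K[n]}.
Implicit Types (I p : set S) (M G : set 'X_{1..n}).

Definition mon_gen M : set S := ideal_gen [set ('X_[m] : S) | m in M].

Definition is_monomial_ideal I : Prop := exists M, I = mon_gen M.

Definition is_squarefree_monomial_ideal I : Prop :=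
  exists M, (forall m, M m -> forall i : 'I_n, (m i <= 1)%N) /\ I = mon_gen M.

(* G is the minimal set G(I) of monomial generators of I, monomials being
   represented by their exponents. *)
Definition is_min_mon_gens I G : Prop :=
  I = mon_gen G /\ forall G', G' `<=` G -> I = mon_gen G' -> G' = G.

Definition is_almost_complete_intersection I : Prop :=
  exists G h, [/\ is_min_mon_gens I G, has_height I h & (G #= `I_h.+1)%card].

Definition is_monomial_prime p : Prop :=
  is_prime_ideal p /\
  exists V : set 'I_n, p = ideal_gen [set ('X_i : S) | i in V].

Definition is_clean I : Prop :=
  exists (r : nat) (I_ : nat -> set S) (p_ : nat -> set S),
    [/\ I_ 0%N = I, I_ r = setT,
        forall i, (i <= r)%N -> is_monomial_ideal (I_ i) &
        forall i, (i < r)%N ->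
          [/\ I_ i `<` I_ i.+1,
              subquotient_isom (I_ i.+1) (I_ i) setT (p_ i),
              is_monomial_prime (p_ i) &
              is_minimal_prime I (p_ i)]].

End MonomialIdeals.

(* Main.v *)
(* Let E be the set of supports of the m = ht I + 1 generators. A cover (hitting
   set) C of E spans a prime containing I of height at most #|C|, so every cover
   has at least m - 1 elements. A clean filtration is read off a decision tree
   querying "does x divide the monomial?": if every rejecting leaf has answered
   "no" exactly on a minimal cover V, then the leaves, "yes" branches first, give
   steps U -> U + (w) with U : w the prime generated by V. To build the tree,
   query first the variables lying in two or more supports. After a first "no",
   greedily querying unhit supports ends with a cover of at most m - 1 elements,
   which is minimal by the bound above. If all these answers are "yes", each
   remaining variable hits at most one support, so one "no" per support is
   again a minimal cover. *)
Require Import Defs.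
From mathcomp Require Import all_boot all_order all_algebra.
From mathcomp Require Import boolp classical_sets functions cardinality.
From mathcomp Require Import mpoly.
From mathcomp Require Import zify ring.

Set Implicit Arguments.
Unset Strict Implicit.
Unset Printing Implicit Defensive.

(* classical_sets shadows set0, subset_trans, etc. *)
Import fintype boot.finset GRing.Theory.

(** * Shellings from decision trees *)

Lemma disjointsU1 (T : finType) (x : T) (A B : {set T}) :
  [disjoint x |: A & B] = (x \notin B) && [disjoint A & B].
Proof. by rewrite -!setI_eq0 setIUl setU_eq0 !setI_eq0 disjoints1. Qed.

Section Shelling.
Variables (T : finType) (E : {set {set T}}).
Implicit Types (A C P Q V w e : {set T}) (U : {set {set T}}) (x : T).

Definition hits C e := ~~ [disjoint C & e].
Definition is_cover C := [forall e in E, hits C e].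
Definition upset w : {set {set T}} := [set A : {set T} | w \subset A].
Definition edge_upset : {set {set T}} :=
  [set A : {set T} | [exists e in E, e \subset A]].

(** Sets of variables stand for supports of monomials. A step adjoins the square-free monomial with
    support [w]; the conditions on [V] make the colon by that monomial the minimal prime generated
    by [V]. *)
Inductive shelling : {set {set T}} -> {set {set T}} -> Prop :=
| shelling_refl U : shelling U U
| shelling_step U U' w V :
    minset is_cover V -> [disjoint V & w] ->
    (forall A, w \subset A -> (A \in U) = hits V A) ->
    shelling (U :|: upset w) U' -> shelling U U'.

Lemma shelling_trans U2 U1 U3 :
  shelling U1 U2 -> shelling U2 U3 -> shelling U1 U3.
Proof.
by elim=> // U U' w V minV dVw UE _ IH /IH; apply: shelling_step UE.
Qed.

Lemma hitsS C e1 e2 : e1 \subset e2 -> hits C e1 -> hits C e2.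
Proof. by move=> s12; apply: contra; apply: disjointWr. Qed.

Lemma hitsU1 x C e : hits (x |: C) e = (x \in e) || hits C e.
Proof. by rewrite /hits disjointsU1 negb_and negbK. Qed.

(* A node of the decision tree: the sets containing P and avoiding Q are still
   to be treated, those containing P and meeting Q have been treated. *)
Definition solvable P Q := forall U,
  (forall A, P \subset A -> (A \in U) = (A \in edge_upset) || hits Q A) ->
  shelling U (U :|: upset P).

Lemma solvable_edge P Q e : e \in E -> e \subset P -> solvable P Q.
Proof.
move=> eE eP U UE; suff -> : U :|: upset P = U by apply: shelling_refl.
apply/setUidPl/subsetP => A; rewrite inE => PA; rewrite UE // inE.
by apply/orP; left; apply/exists_inP; exists e => //; apply: subset_trans PA.
Qed.

(** A rejecting leaf is a single step with [w = P] and [V = Q]: every set containing an edge meets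
    the cover [Q], so above [P] membership in [U] reduces to meeting [Q]. *)
Lemma solvable_cover P Q :
  minset is_cover Q -> [disjoint Q & P] -> solvable P Q.
Proof.
move=> minQ dQP U UE.
apply: (shelling_step minQ dQP) (shelling_refl _) => A PA.
rewrite UE // orb_idl // inE => /exists_inP[e eE eA].
by apply: hitsS eA _; have /minsetP[/forall_inP Qcov _] := minQ; apply: Qcov.
Qed.

(** The yes branch goes first. Once the sets containing [x |: P] are treated, every untreated set
    above [P] avoids [x] as well as [Q], which is the node of the no branch. *)
Lemma solvable_query x P Q :
  solvable (x |: P) Q -> solvable P (x |: Q) -> solvable P Q.
Proof.
move=> solP solQ U UE.
have PxP : upset (x |: P) \subset upset P.
  apply/subsetP => A; rewrite !inE; apply: subset_trans; exact: subsetUr.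
apply: shelling_trans (solP U _) _ => [A xPA|].
  by apply: UE; apply: subset_trans xPA; apply: subsetUr.
suff: shelling (U :|: upset (x |: P)) (U :|: upset (x |: P) :|: upset P).
  by rewrite -setUA (setUidPr PxP).
apply: solQ => A PA; rewrite in_setU UE // hitsU1.
rewrite [A \in upset _]inE subUset PA sub1set andbT.
by rewrite -orbA; congr orb; rewrite orbC.
Qed.

Definition unhit Q := [set e in E | ~~ hits Q e].

Lemma unhitU1 x Q : unhit (x |: Q) = unhit Q :\: [set e in E | x \in e].
Proof.
apply/setP => e; rewrite !inE hitsU1 negb_or.
by case: (e \in E) => //=; case: (x \in e).
Qed.

(** Query a vertex of an unhit edge: a no adds one vertex to [Q] and hits at least one more edge, so
    the sum stays bounded by [k]. When [Q] is a cover it is minimal, since any cover inside it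
    avoids [P] and has at least [k] elements. *)
Lemma solvable_greedy k P Q :
  [disjoint Q & P] ->
  (forall C, is_cover C -> [disjoint C & P] -> k <= #|C|) ->
  #|Q| + #|unhit Q| <= k -> solvable P Q.
Proof.
have [N] := ubnP #|~: (P :|: Q)|; elim: N P Q => // N IH P Q ltN dQP minP leQ.
have [uhit0|[e]] := set_0Vmem (unhit Q).
  apply: solvable_cover => //; apply/minsetP; split=> [|C Ccov CQ].
    apply/forall_inP => e eE; apply: contraT => he.
    by have := in_set0 e; rewrite -uhit0 !inE eE he.
  apply/eqP; rewrite eqEcard CQ; apply: leq_trans (minP C Ccov _).
    by apply: leq_trans leQ; apply: leq_addr.
  exact: disjointWl CQ dQP.
rewrite !inE => /andP[eE /[!negbK] dQe].
have [eP|/subsetPn[x xe xP]] := boolP (e \subset P).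
  exact: solvable_edge eE eP.
have xQ : x \notin Q by apply/negP => /(disjointFr dQe); rewrite xe.
have subN (S : {set T}) : x |: (P :|: Q) \subset S -> #|~: S| < N.
  move=> sub; apply: leq_trans (_ : #|~: (P :|: Q)| <= N) => //.
  apply: proper_card; rewrite properC.
  apply: proper_sub_trans sub; apply: properUr; rewrite sub1set inE negb_or.
  by rewrite xP xQ.
apply: (@solvable_query x); apply: IH => //.
- by apply: subN; rewrite setUA.
- by rewrite disjoint_sym disjointsU1 xQ disjoint_sym.
- move=> C Ccov dC; apply: minP => //; apply: disjointWr dC; exact: subsetUr.
- by apply: subN; rewrite setUCA.
- by rewrite disjointsU1 xP.
apply: leq_trans leQ; rewrite cardsU1 xQ add1n addSn -addnS leq_add2l unhitU1.
apply: proper_card; rewrite properEneq subsetDl andbT.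
apply/eqP => /setP/(_ e); rewrite !inE eE xe /= /hits.
by rewrite dQe.
Qed.

Lemma shelling_edge_upset :
  (forall C, is_cover C -> #|E| <= #|C|.+1) -> shelling edge_upset setT.
Proof.
move=> leE; pose D := [set x | 1 < #|[set e in E | x \in e]|].
suff solP P : P \subset D -> solvable P set0.
  have {1}-> : [set: {set T}] = edge_upset :|: upset set0.
    by apply/setP => A; rewrite !inE sub0set orbT.
  apply: solP; rewrite ?sub0set // => A _.
  by rewrite /hits -setI_eq0 set0I eqxx orbF.
have [N] := ubnP #|D :\: P|; elim: N P => // N IH P ltN PD.
have hit0 : unhit set0 = E.
  by apply/setP => e; rewrite !inE /hits -setI_eq0 set0I eqxx /= andbT.
have d0 P' : [disjoint set0 & P'] by rewrite -setI_eq0 set0I.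
have [DP|/subsetPn[x xD xP]] := boolP (D \subset P).
  (* All of [D] was answered yes. A cover avoiding [P] then needs a separate element for each edge,
     hence [k = #|E|] with [Q] still empty. *)
  apply: (@solvable_greedy #|E|); rewrite ?d0 ?cards0 ?hit0 // => C Ccov dCP.
  have hitP e : e \in E -> exists x, x \in C :&: e.
    move=> /(forall_inP Ccov); rewrite /hits -setI_eq0 => /set0Pn[x].
    by exists x.
  have [E0|[e0 e0E]] := set_0Vmem E; first by rewrite E0 cards0.
  have [x0 _] := hitP _ e0E.
  pose f e := odflt x0 [pick x in C :&: e].
  have fP e : e \in E -> f e \in C :&: e.
    by move=> /hitP[x xCe]; rewrite /f; case: pickP => //= /(_ x); rewrite xCe.
  rewrite -(card_in_imset (f := f)) => [|e1 e2 e1E e2E fE].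
    by apply: subset_leq_card; apply/subsetP => _ /imsetP[e /fP /setIP[+ _] ->].
  (* A variable outside [D] lies in at most one edge, which makes [f] injective on [E]. *)
  have /setIP[fC fe1] := fP _ e1E; have /setIP[_ fe2] := fP _ e2E.
  rewrite -fE in fe2; have: f e1 \notin D.
    by apply/negP => /(subsetP DP); rewrite (disjointFr dCP).
  rewrite inE -leqNgt => /card_le1_eqP; apply; rewrite inE ?e1E ?e2E //.
apply: (@solvable_query x).
  apply: IH; last by rewrite subUset sub1set xD.
  apply: leq_trans (_ : #|D :\: P| <= N) => //; rewrite setUC -setDDl.
  by rewrite [in leqRHS](cardsD1 x) in_setD xP xD add1n ltnS.
(* First no, at [x] in [D]: at least two edges are hit at once, so one plus the number of unhit
   edges is at most [#|E|.-1], a lower bound for all covers. *)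
apply: (@solvable_greedy #|E|.-1); first by rewrite setU0 disjoints1.
  by move=> C /leE; lia.
rewrite setU0 cards1 -[[set x]]setU0 unhitU1 hit0.
rewrite cardsDS //; last first.
  by apply/subsetP => e; rewrite inE => /andP[].
move: xD; rewrite inE => xD.
have : #|[set e in E | x \in e]| <= #|E|.
  by apply: subset_leq_card; apply/subsetP => e; rewrite inE => /andP[].
by lia.
Qed.

End Shelling.

Local Open Scope ring_scope.

(** * Ideals and chains of primes *)

Section IdealFacts.
Variable R : comNzRingType.
Implicit Types (I P : set R).

Lemma is_idealP I :
  is_ideal I <-> I 0 /\ (forall a u v, I u -> I v -> I (a * u + v)).
Proof.
split=> [[I0 IM]|[I0 IM]]; split.
- exact: set_mem I0.
- by move=> a u v Iu Iv; apply: set_mem; apply: IM; apply: mem_set.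
- exact: mem_set.
by move=> a u v Iu Iv; apply: mem_set; apply: IM; apply: set_mem.
Qed.

Lemma is_prime_idealP P :
  is_prime_ideal P <->
  [/\ is_ideal P, ~ P 1 & forall u v, P (u * v) -> P u \/ P v].
Proof.
split=> [[[P0 P1 PM] Ppr]|[/is_idealP[P0 PM] P1 Ppr]].
  split; first (apply/is_idealP; split; first exact: set_mem P0).
  - by move=> a u v Pu Pv; apply: set_mem; apply: PM; apply: mem_set.
  - by move=> /mem_set; apply/negP.
  by move=> u v /mem_set/Ppr/orP[] /set_mem; [left|right].
split; first split.
- exact: mem_set.
- by apply/negP => /set_mem.
- by move=> a u v Pu Pv; apply: mem_set; apply: PM; apply: set_mem.
by move=> u v /set_mem/Ppr[] /mem_set->; rewrite ?orbT.
Qed.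

Section Closure.
Variable I : set R.
Hypothesis idealI : is_ideal I.

Lemma ideal0 : I 0. Proof. by have /is_idealP[] := idealI. Qed.

Lemma idealMl a u : I u -> I (a * u).
Proof.
have /is_idealP[I0 IM] := idealI; move=> Iu.
by rewrite -[_ * _]addr0; apply: IM.
Qed.

Lemma idealD u v : I u -> I v -> I (u + v).
Proof.
by have /is_idealP[I0 IM] := idealI; rewrite -{2}[u]mul1r; apply: IM.
Qed.

Lemma idealN u : I u -> I (- u).
Proof. by rewrite -mulN1r; apply: idealMl. Qed.

Lemma idealB u v : I u -> I v -> I (u - v).
Proof. by move=> Iu /idealN; apply: idealD. Qed.

Lemma ideal_sum (J : Type) (r : seq J) (P : pred J) (F : J -> R) :
  (forall j, P j -> I (F j)) -> I (\sum_(j <- r | P j) F j).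
Proof.
by move=> IF; elim/big_rec: _ => [|j u Pj]; [exact: ideal0 | apply/idealD/IF].
Qed.

End Closure.

Lemma prime_prod P (J : Type) (r : seq J) (Q : pred J) (F : J -> R) :
  is_prime_ideal P -> P (\prod_(j <- r | Q j) F j) -> exists2 j, Q j & P (F j).
Proof.
move=> /is_prime_idealP[_ P1 PM]; elim/big_rec: _ => // j u Qj IH.
by move=> /PM[PF|/IH//]; exists j.
Qed.

Lemma prime_expn P u k : is_prime_ideal P -> P (u ^+ k) -> P u.
Proof.
move=> /is_prime_idealP[_ P1 PM]; elim: k => [|k IH]; first by rewrite expr0.
by rewrite exprS => /PM[|/IH].
Qed.

Lemma ideal_gen_ideal (X : set R) : is_ideal (ideal_gen X).
Proof.
apply/is_idealP; split=> [A [/is_idealP[]]//|a u v Iu Iv A AX].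
have [/is_idealP[_ AM] _] := AX.
by apply: AM; [apply: Iu | apply: Iv].
Qed.

End IdealFacts.

(* Of the terms whose exponents are lexicographically minimal, the coefficients
   survive: at each step the common power of f i is cancelled in the prime Q i,
   which does not contain f i, and the other multiples of f i die in Q i.+1. *)
Lemma prime_chain_peel (R : comNzRingType) (J : finType) k
    (Q : nat -> set R) (f : nat -> R) (e : J -> nat -> nat) (c : J -> R)
    (A : {set J}) :
  (forall i, (i <= k)%N -> is_prime_ideal (Q i)) ->
  (forall i, (i < k)%N -> (Q i `<=` Q i.+1)%classic) ->
  (forall i, (i < k)%N -> Q i.+1 (f i) /\ ~ Q i (f i)) ->
  (0 < #|A|)%N ->
  Q 0%N (\sum_(j in A) c j * \prod_(i < k) f i ^+ e j i) ->
  exists B : {set J}, [/\ (0 < #|B|)%N, B \subset A,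
    {in B &, forall j1 j2 i, (i < k)%N -> e j1 i = e j2 i} &
    Q k (\sum_(j in B) c j)].
Proof.
elim: k Q f e A => [|k IH] Q f e A primeQ subQ Qf A0 QA.
  exists A; split=> //; move: QA.
  by under eq_bigr do rewrite big_ord0 mulr1.
have /card_gt0P[j0 Aj0] := A0.
have [j1 Aj1 minj1] := arg_minnP (fun j => e j 0%N) Aj0.
set d := e j1 0%N in minj1.
pose B := [set j in A | e j 0%N == d].
pose g j := c j * \prod_(i < k) f i.+1 ^+ e j i.+1.
have /is_prime_idealP[_ _ Q0M] := primeQ 0%N isT.
have idQ1 : is_ideal (Q 1%N) by have /is_prime_idealP[] := primeQ 1%N isT.
have [Q1f0 Q0f0] := Qf 0%N isT.
have {}QA : Q 1%N (\sum_(j in A) f 0%N ^+ (e j 0%N - d) * g j).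
  apply: subQ => //; move: QA.
  suff -> : \sum_(j in A) c j * \prod_(i < k.+1) f i ^+ e j i =
     f 0%N ^+ d * \sum_(j in A) f 0%N ^+ (e j 0%N - d) * g j.
    by move=> /Q0M[/(prime_expn (primeQ 0%N isT))|].
  rewrite mulr_sumr; apply: eq_bigr => j Aj.
  rewrite mulrA -exprD subnKC ?minj1 // big_ord_recl mulrCA /g.
  by congr (_ * (_ * _)); apply: eq_bigr => i _.
have {}QA : Q 1%N (\sum_(j in B) g j).
  have -> : \sum_(j in B) g j = \sum_(j in A) f 0%N ^+ (e j 0%N - d) * g j -
     \sum_(j in A | e j 0%N != d) f 0%N ^+ (e j 0%N - d) * g j.
    rewrite [X in _ = X - _](bigID (fun j => e j 0%N == d)) /= addrK.
    apply: eq_big => [j|j]; rewrite inE //.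
    by case/andP=> _ /eqP->; rewrite subnn expr0 mul1r.
  apply: idealB => //; apply: ideal_sum => // j /andP[Aj nej].
  have lt_d : (0 < e j 0%N - d)%N.
    by rewrite subn_gt0 ltn_neqAle eq_sym nej minj1.
  by rewrite -(prednK lt_d) exprSr mulrAC; apply: idealMl.
have [|||||C [C0 CB eC QC]] :=
    IH (fun i => Q i.+1) (fun i => f i.+1) (fun j i => e j i.+1) B.
- by move=> i lei; apply: primeQ.
- by move=> i lti; apply: subQ.
- by move=> i lti; apply: Qf.
- by apply/card_gt0P; exists j1; rewrite inE eqxx andbT.
- exact: QA.
exists C; split=> //.
  by apply: (subset_trans CB); apply/subsetP => j; rewrite inE => /andP[].
move=> j2 j3 Cj2 Cj3 [_|i]; last exact: eC.
have := subsetP CB _ Cj2; have := subsetP CB _ Cj3; rewrite !inE.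
by move=> /andP[_ /eqP->] /andP[_ /eqP->].
Qed.

(** * Algebraic dependence of more than [n] polynomials *)

Section Dependence.
Variables (K : fieldType) (n : nat).
Implicit Types (p q : {mpoly K[n]}).

Definition deg_le d p := forall m, m \in msupp p -> (mdeg m <= d)%N.

Lemma deg_leM d1 d2 p q :
  deg_le d1 p -> deg_le d2 q -> deg_le (d1 + d2) (p * q).
Proof.
move=> dp dq m /msuppM_le/allpairsP[[m1 m2] /= [m1p m2q ->]].
by rewrite mdegD leq_add ?dp ?dq.
Qed.

Lemma deg_le_prod (J : finType) (d : J -> nat) (F : J -> {mpoly K[n]}) :
  (forall j, deg_le (d j) (F j)) -> deg_le (\sum_j d j) (\prod_j F j).
Proof.
move=> dF; elim/big_rec2: _ => [m|j p e _]; last exact: deg_leM.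
by rewrite msupp1 inE => /eqP->; rewrite mdeg0.
Qed.

Lemma deg_leX d p k : deg_le d p -> deg_le (k * d) (p ^+ k).
Proof.
move=> dp; have := @deg_le_prod 'I_k (fun=> d) (fun=> p) (fun=> dp).
by rewrite sum_nat_const prodr_const card_ord.
Qed.

(* Dimension count: there are N ^ #|J| monomials in the g j with all exponents
   below N, and their span lies in a space of dimension O(N ^ n). *)
Lemma algebraic_dependence (J : finType) (g : J -> {mpoly K[n]}) :
  (n < #|J|)%N ->
  exists N (v : {ffun J -> 'I_N} -> K), (exists t, v t != 0) /\
    \sum_t v t *: \prod_j g j ^+ t j = 0.
Proof.
move=> ltnJ; pose D := \max_j msize (g j).
have degg j : deg_le D (g j).
  move=> m /msize_mdeg_lt/ltnW; move/leq_trans; apply.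
  by rewrite /D (bigD1 j) //= leq_maxl.
(* These constants give [B ^ n = c ^ n * N ^ n < N ^ n.+1 <= N ^ #|J|], while products with
   exponents below [N] have degree at most [#|J| * N * D < B]. *)
pose c := (#|J| * D).+1; pose N := (c ^ n).+1; pose B := (c * N)%N.
pose P (t : {ffun J -> 'I_N}) := \prod_j g j ^+ t j.
have degP t m : m \in msupp (P t) -> (mdeg m < B)%N.
  have dP : deg_le (\sum_j t j * D) (P t).
    by apply: deg_le_prod => j; apply: deg_leX.
  move=> /dP/leq_ltn_trans; apply; rewrite -big_distrl /=.
  apply: (@leq_ltn_trans (#|J| * N * D)).
    rewrite leq_mul2r; apply/orP; right.
    rewrite -sum_nat_const leq_sum // => j _.
    exact: ltnW.
  by rewrite /B /c mulnAC mulSn; lia.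
pose T := {ffun J -> 'I_N}; pose T' := {ffun 'I_n -> 'I_B}.
pose M : 'M[K]_(#|T|, #|T'|) :=
  \matrix_(i, j) (P (enum_val i))@_[multinom (enum_val j : T') x : nat | x < n].
have ltT : (#|T'| < #|T|)%N.
  rewrite !card_ffun !card_ord; apply: (@leq_trans (N ^ n.+1)); last first.
    by rewrite leq_pexp2l.
  by rewrite expnMn expnS ltn_mul2r expn_gt0 /= ltnS.
have /rowV0Pn[w /sub_kermxP wM w0] : kermx M != 0.
  rewrite kermx_eq0 /row_free neq_ltn; apply/orP; left.
  exact: leq_ltn_trans (rank_leq_col _) ltT.
exists N, (fun t => w 0 (enum_rank t)); split.
  by have /rV0Pn[i wi] := w0; exists (enum_val i); rewrite enum_valK.
apply/mpolyP => m; rewrite mcoeff0 raddf_sum /=.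
(* A monomial with some exponent at least [B] occurs in no product; the others index the columns of
   [M]. *)
have [ltmB|] := boolP [forall i, (m i < B)%N]; last first.
  move=> /forallPn[i]; rewrite -leqNgt => leBm; rewrite big1 // => t _.
  rewrite mcoeffZ; suff -> : (P t)@_m = 0 by rewrite mulr0.
  apply: memN_msupp_eq0; apply/negP => /degP; rewrite mdegE (bigD1 i) //=.
  by lia.
pose s : T' := [ffun i => Ordinal (forallP ltmB i)].
have /rowP/(_ (enum_rank s)) := wM; rewrite !mxE => wM0; rewrite -[RHS]wM0.
rewrite (reindex (@enum_val T predT)) /=; last exact: onW_bij (enum_val_bij _).
apply: eq_bigr => i _; rewrite enum_valK mcoeffZ !mxE enum_rankK.
by congr (_ * _@__); apply/mnmP => x; rewrite mnmE ffunE.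
Qed.

End Dependence.

(** * Square-free monomial ideals *)

Section MonomialSupport.
Variable n : nat.
Implicit Types (m : 'X_{1..n}) (A : {set 'I_n}).

Definition mnm_supp m : {set 'I_n} := [set i | m i != 0%N].

Lemma mnm_suppP m i : (i \in mnm_supp m) = (m i != 0%N).
Proof. by rewrite inE. Qed.

Lemma mnm_suppD m1 m2 : mnm_supp (m1 + m2)%MM = mnm_supp m1 :|: mnm_supp m2.
Proof.
by apply/setP => i; rewrite in_setU !mnm_suppP mnmDE addn_eq0 negb_and.
Qed.

Lemma mnm_suppS m1 m2 : (m1 <= m2)%MM -> mnm_supp m1 \subset mnm_supp m2.
Proof.
move=> /mnm_lepP le12; apply/subsetP => i; rewrite !mnm_suppP -!lt0n => lt0.
exact: leq_trans (le12 i).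
Qed.

Definition mnm_of_set A : 'X_{1..n} := [multinom (i \in A : nat) | i < n].

Lemma mnm_of_setK A : mnm_supp (mnm_of_set A) = A.
Proof. by apply/setP => i; rewrite mnm_suppP mnmE; case: (i \in A). Qed.

Lemma mnm_of_set_le A m : A \subset mnm_supp m -> (mnm_of_set A <= m)%MM.
Proof.
move=> Am; apply/mnm_lepP => i; rewrite mnmE.
by case: (boolP (i \in A)) => //= /(subsetP Am); rewrite mnm_suppP lt0n.
Qed.

End MonomialSupport.

Section MonomialIdeals.
Variables (K : fieldType) (n : nat).
Local Notation S := {mpoly K[n]}.
Implicit Types (I P : set S) (m : 'X_{1..n}) (p q : S).
Implicit Types (U : {set {set 'I_n}}) (w A V C : {set 'I_n}).

Lemma ideal_msupp I p : is_ideal I ->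
  (forall m, m \in msupp p -> I 'X_[m]) -> I p.
Proof.
move=> idealI Im; rewrite (mpolyE p) big_seq; apply: ideal_sum => // m mp.
by rewrite -mul_mpolyC; apply: idealMl => //; apply: Im.
Qed.

Lemma mpoly_ideal (M : 'X_{1..n} -> Prop) :
  (forall m m', M m -> M (m' + m)%MM) ->
  is_ideal (fun p : S => forall m, m \in msupp p -> M m).
Proof.
move=> Mup; apply/is_idealP; split=> [m|a u v Mu Mv m]; first by rewrite msupp0.
move=> /msuppD_le; rewrite mem_cat => /orP[|/Mv//].
by move=> /msuppM_le/allpairsP[[m1 m2] /= [_ /Mu Mm2 ->]]; apply: Mup.
Qed.

(** The right-hand side is an ideal containing the generators; conversely, each term of such a
    polynomial is a multiple of a generator. *)
Lemma mon_genE (M : set 'X_{1..n}) : mon_gen (K := K) M =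
  (fun p : S => forall m, m \in msupp p -> exists2 g, M g & (g <= m)%MM).
Proof.
apply/seteqP; split=> p.
  move=> Ip; apply: (Ip (fun q : S => _)); split.
    apply: mpoly_ideal => m m' [g Mg gm]; exists g => //.
    exact: lepm_trans gm (lem_addl _ _).
  move=> _ [g Mg <-] m; rewrite msuppX mem_seq1 => /eqP->.
  by exists g => //; apply: lepm_refl.
move=> Mp; apply: (ideal_msupp (@ideal_gen_ideal _ _)) => m /Mp[g Mg /submK <-].
rewrite mpolyXD; apply: (idealMl (@ideal_gen_ideal _ _)).
by apply: sub_gen_smallest; exists g.
Qed.

Definition upclosed U :=
  forall A B : {set 'I_n}, A \in U -> A \subset B -> B \in U.

(** For an up-closed [U] this is a square-free monomial ideal; recording only supports turns sums
    and colons into operations on families of sets. *)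
Definition support_ideal U : set S :=
  fun p => forall m, m \in msupp p -> mnm_supp m \in U.

Lemma support_idealX U m : support_ideal U 'X_[m] <-> mnm_supp m \in U.
Proof.
split=> [|Um m']; first by apply; rewrite msuppX mem_seq1.
by rewrite msuppX mem_seq1 => /eqP->.
Qed.

Lemma support_ideal_ideal U : upclosed U -> is_ideal (support_ideal U).
Proof.
move=> upU; apply: mpoly_ideal => m m' Um; apply: (upU _ _ Um).
by rewrite mnm_suppD subsetUr.
Qed.

Lemma support_ideal_gen U : upclosed U ->
  support_ideal U = mon_gen [set m | mnm_supp m \in U]%classic.
Proof.
move=> upU; rewrite mon_genE; apply/seteqP; split=> p Up m /Up.
  by move=> Um; exists m => //; apply: lepm_refl.
by move=> [g /= Ug /mnm_suppS]; apply: upU.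
Qed.

Lemma support_idealT : support_ideal setT = [set: S]%classic.
Proof. by apply/seteqP; split=> // p _ m _; rewrite inE. Qed.

Lemma support_ideal_mulX U p m0 : support_ideal U (p * 'X_[m0]) <->
  (forall m, m \in msupp p -> mnm_supp m0 :|: mnm_supp m \in U).
Proof.
split=> Up m; last first.
  rewrite (perm_mem (msuppMX _ _)) => /mapP[m' /Up Um' ->].
  by rewrite mnm_suppD.
move=> mp; rewrite -mnm_suppD; apply: Up.
by rewrite (perm_mem (msuppMX _ _)); apply/mapP; exists m.
Qed.

(** The prime generated by the variables in [V], in support form. *)
Definition var_ideal V : set S := support_ideal [set A : {set 'I_n} | hits V A].

Lemma hits_upclosed V : upclosed [set A : {set 'I_n} | hits V A].
Proof. by move=> A B; rewrite !inE => VA AB; apply: hitsS VA. Qed.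

Lemma hitsP V A : reflect (exists2 i, i \in V & i \in A) (hits V A).
Proof.
rewrite /hits -setI_eq0; apply: (iffP (set0Pn _)) => [[i /setIP[]]|[i iV iA]].
  by exists i.
by exists i; apply/setIP.
Qed.

Lemma var_idealXU V i : var_ideal V 'X_i <-> i \in V.
Proof.
split=> [/support_idealX|iV].
  by rewrite inE => /hitsP[j jV]; rewrite mnm_suppP mnm1E eqb0 negbK => /eqP->.
apply/support_idealX; rewrite inE; apply/hitsP; exists i => //.
by rewrite mnm_suppP mnm1E eqxx.
Qed.

Lemma var_ideal_gen V :
  var_ideal V = ideal_gen [set ('X_i : S) | i in [set` V]]%classic.
Proof.
have -> : [set ('X_i : S) | i in [set` V]]%classic =
   [set 'X_[m] | m in [set U_(i)%MM | i in [set` V]]]%classic.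
  by rewrite image_comp.
rewrite -/(mon_gen _) mon_genE; apply/seteqP; split=> p Vp m /Vp.
  rewrite inE => /hitsP[i iV im]; exists U_(i)%MM; first by exists i.
  by rewrite lep1mP -mnm_suppP.
move=> [_ [i iV <-]]; rewrite lep1mP -mnm_suppP => im.
by rewrite inE; apply/hitsP; exists i.
Qed.

(* The variable ideal is the kernel of the substitution sending the variables
   of V to 0. *)
Lemma var_ideal_prime V : is_prime_ideal (var_ideal V).
Proof.
pose lq := [tuple (if i \in V then 0 else 'X_i : S) | i < n].
pose phi p : S := p \mPo lq.
have phiX m : phi 'X_[m] = if hits V (mnm_supp m) then 0 else 'X_[m].
  rewrite /phi comp_mpolyX; case: hitsP => [[i iV im]|noti].
    rewrite (bigD1 i) //= tnth_mktuple iV expr0n.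
    by move: im; rewrite mnm_suppP => /negPf->; rewrite mul0r.
  rewrite [RHS]mpolyXE_id; apply: eq_bigr => i _; rewrite tnth_mktuple.
  case: ifP => // iV; have /eqP-> : m i == 0%N.
    by apply: contraT => mi; case: noti; exists i; rewrite ?mnm_suppP.
  by rewrite !expr0.
have phiE p m : (phi p)@_m = if hits V (mnm_supp m) then 0 else p@_m.
  rewrite {1}(mpolyE p) [phi _]raddf_sum raddf_sum /=.
  rewrite [in RHS](mpolyE p) raddf_sum /=.
  transitivity (\sum_(i <- msupp p)
      if hits V (mnm_supp m) then 0 else (p@_i *: 'X_[i])@_m); last first.
    by case: ifP => // _; rewrite big1.
  apply: eq_bigr => i _; rewrite comp_mpolyZ mcoeffZ -/(phi _) phiX.
  rewrite [in RHS]mcoeffZ mcoeffX.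
  have [<-|neim] := eqVneq i m; last rewrite mulr0 if_same.
    by case: ifP; rewrite ?mcoeff0 ?mcoeffX ?eqxx ?mulr0.
  by case: ifP; rewrite ?mcoeff0 ?mcoeffX ?(negPf neim) mulr0.
have phi0 p : var_ideal V p <-> phi p = 0.
  split=> [Vp|/mpolyP phip m].
    apply/mpolyP => m; rewrite phiE mcoeff0; case: ifPn => // hm.
    by apply: memN_msupp_eq0; apply: contra hm => /Vp; rewrite inE.
  rewrite mcoeff_msupp inE; apply: contraNT => hm.
  by have := phip m; rewrite phiE (negPf hm) mcoeff0 => ->.
apply/is_prime_idealP; split.
- exact/support_ideal_ideal/hits_upclosed.
- by rewrite phi0 /phi comp_mpoly1; apply/eqP; rewrite oner_eq0.
move=> u v; rewrite !phi0 /phi rmorphM /= => /eqP; rewrite mulf_eq0.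
by case/orP=> /eqP; [left|right].
Qed.

Lemma var_ideal_monomial_prime V : is_monomial_prime (var_ideal V).
Proof.
split; first exact: var_ideal_prime.
by exists [set` V]%classic; apply: var_ideal_gen.
Qed.

Lemma prime_mpolyX P m :
  is_prime_ideal P -> P 'X_[m] -> exists2 i, i \in mnm_supp m & P 'X_i.
Proof.
move=> primeP; rewrite mpolyXE_id => /(prime_prod primeP)[i _ Pi].
exists i; last exact: prime_expn Pi.
rewrite mnm_suppP; apply: contraPneq Pi => ->; rewrite expr0.
by have /is_prime_idealP[] := primeP.
Qed.

Lemma edge_upset_upclosed E : upclosed (edge_upset E).
Proof.
move=> A B; rewrite !inE => /exists_inP[e eE eA] AB.
by apply/exists_inP; exists e => //; apply: subset_trans AB.
Qed.

Lemma var_ideal_cover E C : is_cover E C ->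
  (support_ideal (edge_upset E) `<=` var_ideal C)%classic.
Proof.
move=> /forall_inP covC p Ep m /Ep; rewrite !inE => /exists_inP[e eE em].
by apply: (hitsS em); apply: covC.
Qed.

(** The variables in an intermediate prime [Q] form a cover, because [Q] contains the product over
    each edge and so one of its variables. This cover lies in [V], hence equals [V]. *)
Lemma minimal_cover_prime E V : minset (is_cover E) V ->
  is_minimal_prime (support_ideal (edge_upset E)) (var_ideal V).
Proof.
move=> /minsetP[covV minV].
split; [exact: var_ideal_prime | exact: var_ideal_cover |].
move=> Q primeQ IQ QV; pose C := [set i : 'I_n | `[< Q 'X_i >]].
have {minV} CV : C = V.
  apply: minV; last first.
    by apply/subsetP => i; rewrite inE => /asboolP/QV/var_idealXU.
  apply/forall_inP => e eE.
  have /(prime_mpolyX primeQ)[i] : Q 'X_[mnm_of_set e].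
    apply: IQ; apply/support_idealX; rewrite mnm_of_setK inE.
    by apply/exists_inP; exists e.
  rewrite mnm_of_setK => ie Qi; apply/hitsP; exists i => //.
  by rewrite inE; apply/asboolP.
apply/seteqP; split=> // p; rewrite var_ideal_gen; apply.
split; first by have /is_prime_idealP[] := primeQ.
by move=> _ [i /= + <-]; rewrite -CV inE => /asboolP.
Qed.

End MonomialIdeals.

(** * Height of a prime generated by variables *)

Section Height.
Variables (K : fieldType) (n : nat).
Local Notation S := {mpoly K[n]}.
Implicit Type V : {set 'I_n}.

(* A longer chain would give, with the variables outside V, more than n
   polynomials; peeling their algebraic dependence along the chain leaves a
   nonzero polynomial in the variables outside V lying in the ideal of V. *)
Lemma var_ideal_chain_le V k :
  prime_chain (var_ideal V : set S) k -> (k <= #|V|)%N.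
Proof.
case=> Q [primeQ ltQ QV]; rewrite leqNgt; apply/negP => ltVk.
(* Witnesses of the strict inclusions, with 0 as filler beyond the chain. *)
have /choice[f Qf] : forall i, exists u : S,
    (i < k)%N -> Q i.+1 u /\ ~ Q i u.
  move=> i; have [/ltQ[_ /existsNP[u /not_implyP Qu]]|_] := ltnP i k.
    by exists u.
  by exists 0.
pose W := {i : 'I_n | i \notin V}; pose J := ('I_k + W)%type.
pose g (j : J) : S := match j with inl i => f i | inr x => 'X_(val x) end.
have cardJ : (n < #|{: J}|)%N.
  rewrite card_sum card_ord card_sig.
  have -> : #|[pred i | i \notin V]| = #|~: V|.
    by apply: eq_card => i; rewrite !inE.
  by have := cardsC V; rewrite card_ord; lia.
have [N [v [[t0 vt0] vg0]]] := algebraic_dependence g cardJ.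
pose T := {ffun J -> 'I_N}.
pose mon (t : T) : 'X_{1..n} := (\sum_(x : W) U_(val x) *+ t (inr x))%MM.
pose e (t : T) i := if insub i is Some i' then t (inl i') : nat else 0%N.
have monE (t : T) (x : W) : mon t (val x) = t (inr x).
  rewrite /mon mnm_sumE (bigD1 x) //= big1 => [|y neyx].
    by rewrite addn0 mulmnE mnm1E eqxx mul1n.
  by rewrite mulmnE mnm1E (inj_eq val_inj) (negPf neyx).
have monV (t : T) i : i \in V -> mon t i = 0%N.
  move=> iV; rewrite /mon mnm_sumE big1 // => x _.
  rewrite mulmnE mnm1E; case: eqP => // xi.
  by have := valP x; rewrite /= xi iV.
have eE (t : T) (i : 'I_k) : e t i = t (inl i) by rewrite /e valK.
pose A := [set t : T | v t != 0].
have [||||B [B0 BA eB]] := @prime_chain_peel _ T k Q f e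
    (fun t => v t *: 'X_[mon t]) A primeQ.
- by move=> i /ltQ[].
- by move=> i lti; apply: Qf.
- by apply/card_gt0P; exists t0; rewrite inE.
- suff -> : \sum_(t in A) v t *: 'X_[mon t] * \prod_(i < k) f i ^+ e t i = 0.
    by have /is_prime_idealP[/ideal0] := primeQ 0%N isT.
  rewrite -[RHS]vg0 [RHS](bigID (mem A)) /= [X in _ = _ + X]big1 ?addr0.
    apply: eq_bigr => t _; rewrite big_sumType /= -scalerAl mulrC.
    congr (_ *: (_ * _)); first by apply: eq_bigr => i _; rewrite eE.
    by rewrite mprodXnE.
  by move=> t; rewrite inE negbK => /eqP->; rewrite scale0r.
move=> sumB.
have /card_gt0P[t1 Bt1] := B0.
have vt1 : v t1 != 0 by have := subsetP BA _ Bt1; rewrite inE.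
(* On [B] the exponents of the [f i] agree and [mon t] determines the others, so only [t1]
   contributes to this coefficient. *)
have coefB : (\sum_(t in B) v t *: 'X_[mon t] : S)@_(mon t1) = v t1.
  rewrite raddf_sum (bigD1 t1) //= mcoeffZ mcoeffX eqxx mulr1 big1 ?addr0 //.
  move=> t /andP[Bt netn]; rewrite mcoeffZ mcoeffX.
  have [mt|_] := eqVneq (mon t) (mon t1); last by rewrite mulr0.
  case/eqP: netn; apply/ffunP => -[i|x]; apply/val_inj; last first.
    by rewrite /= -!monE mt.
  by rewrite /= -!eE; apply: eB.
have : (var_ideal V : set S) (\sum_(t in B) v t *: 'X_[mon t]) by rewrite -QV.
move=> /(_ (mon t1)); rewrite mcoeff_msupp coefB => /(_ vt1).
by rewrite inE => /hitsP[i iV]; rewrite mnm_suppP monV.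
Qed.

(** A chain of length 0 exists and lengths are bounded, so there is a longest chain; this supplies
    the finite height that [has_height] compares. *)
Lemma var_ideal_height_le V :
  exists2 h, has_prime_height (var_ideal V : set S) h & (h <= #|V|)%N.
Proof.
pose P k := `[< prime_chain (var_ideal V : set S) k >].
have exP : exists k, P k.
  exists 0%N; apply/asboolP; exists (fun=> var_ideal V).
  by split=> // i _; apply: var_ideal_prime.
have [h /asboolP Ph maxh] :=
  ex_maxnP exP (fun k Pk => var_ideal_chain_le (asboolW Pk)).
exists h; last exact: var_ideal_chain_le.
by split=> // k /asboolP; apply: maxh.
Qed.

End Height.

(** * From shellings to clean filtrations *)

Section Filtration.
Variables (K : fieldType) (n : nat).
Local Notation S := {mpoly K[n]}.
Implicit Types (U : {set {set 'I_n}}) (w V : {set 'I_n}).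

(** Here [A] is [B + (x)] and [D] is the colon [B : x]. The map inverts multiplication by [x], from
    [R/D] to [A/B], on chosen representatives. *)
Lemma subquotient_isom_colon (R : comNzRingType) (A B D : set R) (x : R) :
  is_ideal B ->
  (forall u, A u <-> exists g, B (u - x * g)) ->
  (forall g, B (x * g) <-> D g) ->
  subquotient_isom A B [set: R]%classic D.
Proof.
move=> isB AE DE.
have /choice[f fP] : forall u, exists g, A u -> B (u - x * g).
  move=> u; have [/AE[g]|nAu] := pselect (A u); first by exists g.
  by exists 0.
exists f; split=> //.
- move=> a u v Au Av; apply/DE.
  have Auv : A (a * u + v).
    apply/AE; exists (a * f u + f v).
    have -> : a * u + v - x * (a * f u + f v) =
              a * (u - x * f u) + (v - x * f v) by ring.
    by apply: idealD => //; [apply: idealMl => //|]; apply: fP.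
  have -> : x * (f (a * u + v) - (a * f u + f v)) =
    a * (u - x * f u) + (v - x * f v) - (a * u + v - x * f (a * u + v)) by ring.
  apply: idealB => //; last exact: fP.
  by apply: idealD => //; [apply: idealMl => //|]; apply: fP.
- move=> u v Au Av; have Buv : B ((u - x * f u) - (v - x * f v)).
    by apply: idealB => //; apply: fP.
  rewrite -DE; split=> H.
    have -> : u - v = (u - x * f u) - (v - x * f v) + x * (f u - f v) by ring.
    exact: idealD.
  have -> : x * (f u - f v) = (u - v) - ((u - x * f u) - (v - x * f v)) by ring.
  exact: idealB.
move=> g _; have Axg : A (x * g).
  by apply/AE; exists g; rewrite subrr; apply: ideal0.
exists (x * g) => //; apply/DE; rewrite mulrBr -opprB.
by apply: idealN => //; apply: fP.
Qed.

Lemma support_ideal_step U w V : upclosed U -> [disjoint V & w] ->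
  (forall A : {set 'I_n}, w \subset A -> (A \in U) = hits V A) ->
  subquotient_isom (support_ideal (U :|: upset w) : set S) (support_ideal U)
    [set: S]%classic (var_ideal V).
Proof.
move=> upU dVw UE; apply: (@subquotient_isom_colon _ _ _ _ 'X_[mnm_of_set w]).
- exact: support_ideal_ideal.
- move=> p; split=> [Up|[g Ug] m mp].
    (* The polynomials congruent to a multiple of the monomial form an ideal, so it suffices to
       check monomials. *)
    pose I : set S := fun p => exists g,
      support_ideal U (p - 'X_[mnm_of_set w] * g).
    have idealU := @support_ideal_ideal K _ _ upU.
    suff : I p by [].
    apply: ideal_msupp => [|m /Up].
      apply/is_idealP; split.
        by exists 0; rewrite mulr0 subr0; apply: (ideal0 idealU).
      move=> a u v [g Ug] [g' Ug']; exists (a * g + g').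
      have -> : a * u + v - 'X_[mnm_of_set w] * (a * g + g') =
        a * (u - 'X_[mnm_of_set w] * g) + (v - 'X_[mnm_of_set w] * g') by ring.
      by apply: (idealD idealU) => //; apply: (idealMl idealU).
    rewrite in_setU => /orP[Um|].
      by exists 0; rewrite mulr0 subr0; apply/support_idealX.
    rewrite inE => /mnm_of_set_le/submK mE.
    exists 'X_[m - mnm_of_set w]; rewrite -mpolyXD addmC mE subrr.
    exact: (ideal0 idealU).
  rewrite -(subrK ('X_[mnm_of_set w] * g) p) in mp.
  have {mp} := msuppD_le mp; rewrite mem_cat in_setU => /orP[/Ug->//|].
  rewrite mulrC (perm_mem (msuppMX _ _)) => /mapP[m' _ ->].
  by rewrite [X in _ || X]inE mnm_suppD mnm_of_setK subsetUl orbT.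
(* Multiplying by the monomial of [w] adds [w] to a support, and [V] misses [w]; so [V] meets the
   new support exactly when it meets the old one. *)
move=> g; rewrite mulrC; split=> [/support_ideal_mulX Ug m /Ug|Vg].
  rewrite mnm_of_setK UE ?subsetUl // [in X in _ -> X]inE => /hitsP[i iV].
  rewrite in_setU (disjointFr dVw) //= => im.
  by apply/hitsP; exists i.
apply/support_ideal_mulX => m /Vg; rewrite mnm_of_setK UE ?subsetUl // inE.
by apply: hitsS; apply: subsetUr.
Qed.

Lemma shelling_clean (E U U' : {set {set 'I_n}}) :
  shelling E U U' -> U' = setT -> upclosed U ->
  exists (r : nat) (I_ : nat -> set S) (p_ : nat -> set S),
    [/\ I_ 0%N = support_ideal U, I_ r = [set: S]%classic,
        forall i, (i <= r)%N -> is_monomial_ideal (I_ i) &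
        forall i, (i < r)%N ->
          [/\ (I_ i `<` I_ i.+1)%classic,
              subquotient_isom (I_ i.+1) (I_ i) [set: S]%classic (p_ i),
              is_monomial_prime (p_ i) &
              is_minimal_prime (support_ideal (edge_upset E)) (p_ i)]].
Proof.
have monU U1 : upclosed U1 -> is_monomial_ideal (support_ideal U1 : set S).
  by move=> /support_ideal_gen ->; eexists.
elim=> {U U'} [U UT upU|U U' w V minV dVw UE _ IH U'T upU].
  exists 0%N, (fun=> support_ideal U), (fun=> support_ideal U).
  by split=> //; [rewrite UT support_idealT | move=> i _; apply: monU].
have upUw : upclosed (U :|: upset w).
  move=> A B; rewrite !in_setU => /orP[/upU UB /UB->//|].
  by rewrite !inE => wA AB; rewrite (subset_trans wA) ?orbT.
have [r [I_ [p_ [I0 Ir monI Istep]]]] := IH U'T upUw.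
exists r.+1, (fun i => if i is j.+1 then I_ j else support_ideal U).
exists (fun i => if i is j.+1 then p_ j else var_ideal V).
split=> // [[|i] lei|[_|i /Istep//]]; [exact: monU | exact: monI |].
rewrite I0; split; [split | exact: support_ideal_step |
  exact: var_ideal_monomial_prime | exact: minimal_cover_prime].
  by move=> p Up m /Up Um; rewrite in_setU Um.
(* Since [V] misses [w], the monomial with support [w] is new, and the inclusion is strict. *)
have wU : w \notin U.
  by rewrite UE // /hits negbK.
move/(_ 'X_[mnm_of_set w]) => sub; move: wU.
rewrite -{1}[w]mnm_of_setK => /negP; apply.
apply/(@support_idealX K); apply: sub.
by apply/support_idealX; rewrite mnm_of_setK in_setU inE subxx orbT.
Qed.

End Filtration.

Theorem lemma2p4 (K : fieldType) (n : nat) (I : set {mpoly K[n]}) :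
  is_squarefree_monomial_ideal I ->
  is_almost_complete_intersection I ->
  is_clean I.
Proof.
move=> [M [sqfreeM IM]] [G [h [[IG _] [_ leh] cardG]]].
pose E := [set e : {set 'I_n} | `[< exists2 g, G g & mnm_supp g = e >]].
have EP e : reflect (exists2 g, G g & mnm_supp g = e) (e \in E).
  by rewrite inE; apply: asboolP.
have cardE : (#|E| <= h.+1)%N.
  have /card_bijP[f [f' fK f'K]] := cardG.
  rewrite -[h.+1]card_ord.
  pose s i := mnm_supp (val (f' (ordII i))).
  apply: leq_trans (leq_imset_card s predT).
  apply/subset_leq_card/subsetP => _ /EP[g Gg <-]; apply/imsetP.
  exists (IIord (f (SigSub (mem_set Gg)))) => //.
  by rewrite /s IIordK fK.
have IE : I = support_ideal (edge_upset E).
  apply/seteqP; split=> p; rewrite {1}IG mon_genE => Ip m.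
    move=> /Ip[g Gg /mnm_suppS gm]; rewrite inE; apply/exists_inP.
    by exists (mnm_supp g) => //; apply/EP; exists g.
  move=> /Ip; rewrite inE => /exists_inP[_ /EP[g Gg <-] gm].
  (* Some square-free [u] in [M] divides [g]; its exponents being at most 1, it divides every
     monomial whose support contains that of [g]. *)
  have : I 'X_[g] by rewrite IG; apply: sub_gen_smallest; exists g.
  rewrite {1}IM mon_genE => /(_ g); rewrite msuppX mem_seq1 eqxx.
  case=> // u Mu /mnm_suppS ug.
  have : I 'X_[m].
    rewrite IM mon_genE => m'; rewrite msuppX mem_seq1 => /eqP->.
    exists u => //.
    have := subset_trans ug gm => /subsetP um.
    apply/mnm_lepP => i; have := sqfreeM _ Mu i; have := um i.
    by rewrite !mnm_suppP; lia.
  by rewrite IG mon_genE => /(_ m); apply; rewrite msuppX mem_seq1.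
rewrite IE.
suff shE : shelling E (edge_upset E) setT.
  exact: shelling_clean shE erefl (@edge_upset_upclosed _ E).
(* The cover [C] spans a prime over [I] of height at most [#|C|], so [h <= #|C|], while
   [#|E| <= h.+1]. *)
apply: shelling_edge_upset => C covC; apply: leq_trans cardE _; rewrite ltnS.
have [k hk lek] := var_ideal_height_le K C.
apply: leq_trans lek; apply: leh hk; first exact: var_ideal_prime.
by rewrite IE; apply: var_ideal_cover.
Qed.
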